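(* Let $z_i:I\to\mathbb{R}$, $i=1,2,\dots,n-1$, be functions of class $C^\infty$. Then, up to p-similarity, there exists a unique non-null space curve in $\mathbb{E}_1^n$ with p-shape curvatures $z_i$, $i=1,\dots,n-1$.
   Context: $I\subset\mathbb{R}$ is an open interval. $\mathbb{E}_1^n$ is $\mathbb{R}^n$ with the Lorentzian inner product $\mathbf{x}\cdot\mathbf{y}=\mathbf{x}^TI^*\mathbf{y}$, $I^*=\mathrm{diag}(-1,1,\dots,1)$, $\|\mathbf{x}\|=\sqrt{|\mathbf{x}\cdot\mathbf{x}|}$. A p-similarity is a map $f(x)=\mu\mathbf{A}x+\mathbf{b}$ with $\mu\ne0$ real, $\mathbf{A}$ pseudo-orthogonal ($\mathbf{A}^TI^*\mathbf{A}=I^*$) with $\det\mathbf{A}=1$, $\mathbf{b}\in\mathbb{R}^n$. A non-null curve with arc length $s$ is equipped with a Frenet frame: a pseudo-orthonormal frame $\mathbf{e}_1,\dots,\mathbf{e}_n$ with $\mathbf{e}_1=d\alpha/ds$, $\varepsilon_\ell=\mathbf{e}_\ell\cdot\mathbf{e}_\ell\in\{\pm1\}$, satisfying $$\mathbf{e}_1'=\varepsilon_2\kappa_1\mathbf{e}_2,\quad \mathbf{e}_i'=-\varepsilon_{i-1}\kappa_{i-1}\mathbf{e}_{i-1}+\varepsilon_{i+1}\kappa_i\mathbf{e}_{i+1}\ (2\le i\le n-1),\quad \mathbf{e}_n'=-\varepsilon_{n-1}\kappa_{n-1}\mathbf{e}_{n-1},$$ where $'=d/ds$, $\kappa_i=\mathbf{e}_i'\cdot\mathbf{e}_{i+1}$,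 $\kappa_j>0$ for $1\le j\le n-2$ and $\kappa_{n-1}\neq0$. A spherical arc length parameter $\sigma\in I$ is an arc length parameter of the tangent indicatrix $s\mapsto\mathbf{e}_1(s)$, so $d\sigma=\kappa_1ds$. The p-shape curvatures of $\alpha$ are the functions of $\sigma$ given by $\tilde\kappa_1=-\frac1{\kappa_1}\frac{d\kappa_1}{d\sigma}$ and $\tilde\kappa_i=\frac{\kappa_i}{\kappa_1}$ for $i=2,\dots,n-1$.
   Formalization: Added, as the claim fails otherwise: z_i>0 for 2≤i≤n-2 and z_{n-1}≠0 (n≥3), forced by the curvature conditions; uniqueness is among curves with the same causal characters ε_i and, for even n, the same frame determinant; existence is shown for all these choices. *)

(* Defs.v *)
From HB Require Import structures.
From mathcomp Require Import all_boot all_order all_algebra.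
From mathcomp Require Import all_classical all_reals all_analysis.

Set Implicit Arguments.
Unset Strict Implicit.
Unset Printing Implicit Defensive.

Import Order.TTheory GRing.Theory Num.Theory numFieldNormedType.Exports.

Local Open Scope ring_scope.
Local Open Scope classical_set_scope.

(* Functions on an open interval I are represented by total
   functions on R of which only the values on I matter.  The families e
   (frame), eps (causal characters) and z are indexed by naturals counted from
   1, as in e_1, ..., e_n; their values at other indices are irrelevant. *)

Definition open_interval (R : realType) (I : set R) : Prop :=
  open I /\ is_interval I.

Definition smooth_on (R : realType) (V : normedModType R) (I : set R)
    (f : R -> V) : Prop :=
  forall (k : nat) (x : R), I x -> derivable (derive1n k f) x 1.

Definition lmetric (R : realType) (n : nat) : 'M[R]_n :=
  diag_mx (\row_(i < n) (if nat_of_ord i == 0%N then -1 else 1)).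

Definition lprod (R : realType) (n : nat) (x y : 'cV[R]_n) : R :=
  (x^T *m lmetric R n *m y) 0 0.

Definition lnorm (R : realType) (n : nat) (x : 'cV[R]_n) : R :=
  Num.sqrt `|lprod x x|.

Definition p_similarity (R : realType) (n : nat)
    (f : 'cV[R]_n -> 'cV[R]_n) : Prop :=
  exists (mu : R) (A : 'M[R]_n) (b : 'cV[R]_n),
    [/\ mu != 0,
        A^T *m lmetric R n *m A = lmetric R n,
        \det A = 1 &
        forall x, f x = mu *: (A *m x) + b].

(* The derivative dF/ds, by the chain rule, when both F and s are given as
   functions of another parameter x of the curve. *)
Definition dds (R : realType) (V : normedModType R) (s : R -> R)
    (F : R -> V) : R -> V :=
  fun x => (derive1 s x)^-1 *: derive1 F x.

Definition non_null (R : realType) (n : nat) (I : set R)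
    (alpha : R -> 'cV[R]_n) : Prop :=
  forall x, I x -> lprod (derive1 alpha x) (derive1 alpha x) != 0.

(* No sense of traversal is imposed: s may be increasing or decreasing in the
   given parameter. *)
Definition arc_length (R : realType) (n : nat) (I : set R)
    (alpha : R -> 'cV[R]_n) (s : R -> R) : Prop :=
  smooth_on I s /\
  forall x, I x -> derive1 s x != 0 /\ lnorm (dds s alpha x) = 1.

Definition curvature (R : realType) (n : nat) (s : R -> R)
    (e : nat -> R -> 'cV[R]_n) (i : nat) : R -> R :=
  fun x => lprod (dds s (e i) x) (e i.+1 x).

(* By Sylvester's law of inertia these are the possible causal characters of a
   pseudo-orthonormal frame. *)
Definition causal_characters (R : realType) (n : nat) (eps : nat -> R) : Prop :=
  exists t : nat, (1 <= t <= n)%N /\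
    forall i, (1 <= i <= n)%N -> eps i = if i == t then -1 else 1.

Definition frame_mx (R : realType) (n : nat) (e : nat -> R -> 'cV[R]_n)
    (x : R) : 'M[R]_n :=
  \matrix_(i < n, j < n) e j.+1 x i 0.

Record frenet_frame (R : realType) (n : nat) (I : set R) (eps : nat -> R)
    (alpha : R -> 'cV[R]_n) (s : R -> R) (e : nat -> R -> 'cV[R]_n) : Prop := {
  frenet_smooth : forall i, (1 <= i <= n)%N -> smooth_on I (e i) ;
  frenet_orthonormal : forall i j x, (1 <= i <= n)%N -> (1 <= j <= n)%N -> I x ->
    lprod (e i x) (e j x) = if i == j then eps i else 0 ;
  frenet_tangent : forall x, I x -> e 1 x = dds s alpha x ;
  frenet_first : forall x, I x ->
    dds s (e 1) x = (eps 2 * curvature s e 1 x) *: e 2 x ;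
  frenet_mid : forall i x, (2 <= i <= n.-1)%N -> I x ->
    dds s (e i) x =
      - (eps i.-1 * curvature s e i.-1 x) *: e i.-1 x
      + (eps i.+1 * curvature s e i x) *: e i.+1 x ;
  frenet_last : forall x, I x ->
    dds s (e n) x = - (eps n.-1 * curvature s e n.-1 x) *: e n.-1 x ;
  frenet_pos : forall j x, (1 <= j <= n - 2)%N -> I x -> 0 < curvature s e j x ;
  frenet_neq0 : forall x, I x -> curvature s e n.-1 x != 0
}.

(* The parameter of the curve is itself an arc length parameter sigma of the
   tangent indicatrix e_1, with d sigma = kappa_1 ds. *)
Definition spherical_arc_length (R : realType) (n : nat) (I : set R)
    (s : R -> R) (e : nat -> R -> 'cV[R]_n) : Prop :=
  arc_length I (e 1) (fun sigma => sigma) /\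
  forall sigma, I sigma -> dds s (fun x : R => x) sigma = curvature s e 1 sigma.

Definition p_shape_curvature (R : realType) (n : nat) (s : R -> R)
    (e : nat -> R -> 'cV[R]_n) (i : nat) (sigma : R) : R :=
  if i == 1%N
  then - (curvature s e 1 sigma)^-1 * derive1 (curvature s e 1) sigma
  else curvature s e i sigma / curvature s e 1 sigma.

(* alpha, parametrized by a spherical arc length sigma in I, is a non-null
   curve carrying a Frenet frame with causal characters eps and determinant d
   (d = 1 or d = -1: replacing e_n by - e_n changes the signs of d and of the
   last curvature), and its p-shape curvatures are z_1, ..., z_(n-1). *)
Definition has_p_shape_curvatures (R : realType) (n : nat) (I : set R)
    (eps : nat -> R) (d : R) (z : nat -> R -> R) (alpha : R -> 'cV[R]_n)
    : Prop :=
  smooth_on I alpha /\ non_null I alpha /\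
  exists (s : R -> R) (e : nat -> R -> 'cV[R]_n),
    [/\ arc_length I alpha s,
        frenet_frame I eps alpha s e,
        (forall sigma, I sigma -> \det (frame_mx e sigma) = d),
        spherical_arc_length I s e &
        forall i sigma, (1 <= i <= n.-1)%N -> I sigma ->
          p_shape_curvature s e i sigma = z i sigma].

(* Main.v *)
(* In the spherical parameter sigma the Frenet equations become a linear system
   M' = M E S for the frame matrix M, where E = diag(eps_1, ..., eps_n) and the
   skew matrix S has entries 1, z_2, ..., z_(n-1), while q = ds/dsigma =
   1 / kappa_1 satisfies q' = z_1 q and the curve satisfies alpha' = q e_1.

   Existence: solve the system by Picard iteration, which converges on the whole
   interval because the system is linear.  M E M^T is conserved, so M stays
   pseudo-orthonormal; then det M squares to 1 and is constant.

   Uniqueness: for two frames M, N with the same z, the matrix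
   A = N E M^T G (G the Lorentzian metric) is constant and pseudo-orthogonal with
   N = A M, and the ratio mu of the two functions q is constant, so
   beta = mu A alpha + b.  If n is odd and det A = -1, use (- mu) (- A). *)
Require Import Defs.
From mathcomp Require Import all_boot all_order perm all_algebra.
From mathcomp Require Import all_classical all_reals all_analysis.
From mathcomp Require Import ring lra zify.
Import Order.TTheory GRing.Theory Num.Theory numFieldNormedType.Exports.
Local Open Scope ring_scope.
Local Open Scope classical_set_scope.

Set Implicit Arguments.
Unset Strict Implicit.
Unset Printing Implicit Defensive.

(** * Primitives and linear differential systems *)

Lemma is_derive_continuous (R : realType) (f : R -> R) (x df : R) :
  is_derive x 1 f df -> {for x, continuous f}.
Proof. by move=> fdf; apply/differentiable_continuous/derivable1_diffP. Qed.

Lemma is_derive_seg_continuous (R : realType) (f df : R -> R) (a b : R) :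
  (forall t, a <= t <= b -> is_derive t 1 f (df t)) ->
  {within `[a, b], continuous f}.
Proof.
move=> fdf; apply: derivable_within_continuous => t.
by rewrite in_itv/= => /fdf -[].
Qed.

Lemma le_increment (R : realType) (f df g dg : R -> R) (a b : R) : a <= b ->
  (forall t, a <= t <= b -> is_derive t 1 f (df t)) ->
  (forall t, a <= t <= b -> is_derive t 1 g (dg t)) ->
  (forall t, a <= t <= b -> df t <= dg t) ->
  f b - f a <= g b - g a.
Proof.
move=> ab fdf gdg dfg.
have D t : a <= t <= b -> is_derive t 1 (g - f) (dg t - df t).
  by move=> tab; have ? := fdf _ tab; have ? := gdg _ tab; exact: is_deriveB.
have [||c cab] := @MVT_segment R (g - f) (fun t => dg t - df t) a b ab.
- by move=> t; rewrite in_itv/= => /andP[/ltW a1 /ltW b1]; apply: D; rewrite a1.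
- exact: is_derive_seg_continuous D.
rewrite in_itv/= in cab.
move=> E; have : 0 <= (dg c - df c) * (b - a).
  by rewrite mulr_ge0 ?subr_ge0 ?dfg.
by rewrite -E /= -[(g - f) b]/(g b - f b) -[(g - f) a]/(g a - f a) => ?; lra.
Qed.

(** A mean value inequality with a majorant [g]. Every later estimate on solutions goes through it,
    so no bound on the norm of an integral is required. *)
Lemma ler_norm_increment (R : realType) (f df g dg : R -> R) (a b : R) : a <= b ->
  (forall t, a <= t <= b -> is_derive t 1 f (df t)) ->
  (forall t, a <= t <= b -> is_derive t 1 g (dg t)) ->
  (forall t, a <= t <= b -> `|df t| <= dg t) ->
  `|f b - f a| <= g b - g a.
Proof.
move=> ab fdf gdg dfg; rewrite ler_norml; apply/andP; split; last first.
  by apply: le_increment fdf gdg _ => // t /dfg; rewrite ler_norml => /andP[].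
have D t : a <= t <= b -> is_derive t 1 (- f) (- df t).
  by move=> tab; have ? := fdf _ tab; exact: is_deriveN.
rewrite lerNl opprB.
have -> : f a - f b = (- f) b - (- f) a by rewrite /= opprK addrC.
apply: le_increment D gdg _ => // t /dfg; rewrite ler_norml => /andP[? _].
by rewrite lerNl.
Qed.

Lemma is_derive_0_cst_on (R : realType) (I : set R) (f : R -> R) :
  is_interval I -> (forall t, I t -> is_derive t 1 f 0) ->
  forall x y, I x -> I y -> f x = f y.
Proof.
move=> itvI f0 x y.
wlog xy : x y / x <= y.
  by move=> H Ix Iy; case: (leP x y) => [|/ltW] /H; [|symmetry]; auto.
move=> Ix Iy; apply/esym/eqP; rewrite -subr_eq0 -normr_le0.
have Is t : x <= t <= y -> I t by exact: itvI.
apply: le_trans (@ler_norm_increment R f (fun=> 0) (cst 0) (fun=> 0) x y xy _ _ _) _.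
- by move=> t /Is /f0.
- by move=> t _; rewrite normr0.
- by rewrite /cst subrr.
Qed.

Lemma is_derive_expR_lin (R : realType) (c m t0 t : R) :
  is_derive t 1 (fun u => c * expR (m * (u - t0))) (c * (m * expR (m * (t - t0)))).
Proof.
have d0 : is_derive t 1 (id - cst t0) (1 - 0) by exact: is_deriveB.
have d1 : is_derive t 1 (m \*: (id - cst t0)) (m *: (1 - 0)) by exact: is_deriveZ.
have d2 := @is_derive1_comp R expR _ t _ _ (is_derive_expR _) d1.
apply: is_derive_eq (is_deriveZ c d2) _.
by rewrite subr0 /= -![_ *: _]/(_ * _) mulr1 [expR _ * m]mulrC.
Qed.

(** On each side of [x0] the bound on [df] has the primitive [c / m * expR (m * (t - x0))], with [c]
    and [m] negated on the left, and the leftover [c / m] at [x0] has the right sign to be dropped.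
    The gain is the factor [1 / m]. *)
Lemma ler_norm_increment_expR (R : realType) (f df : R -> R) (c m a b x0 x : R) :
  0 < m -> a <= x0 <= b -> a <= x <= b ->
  (forall t, a <= t <= b -> is_derive t 1 f (df t)) ->
  (forall t, a <= t <= b -> `|df t| <= c * expR (m * `|t - x0|)) ->
  `|f x - f x0| <= c / m * expR (m * `|x - x0|).
Proof.
move=> m0 x0ab xab fdf dfle.
(* The bound on [df] at [t = x0] reads [|df x0| <= c]. *)
have c0 : 0 <= c.
  have := dfle _ x0ab; rewrite subrr normr0 mulr0 expR0 mulr1.
  exact: le_trans (normr_ge0 _).
have cm0 : 0 <= c / m by rewrite divr_ge0// ltW.
have mN0 : m != 0 by rewrite gt_eqF.
have [x0x|/ltW xx0] := leP x0 x.
  apply: le_trans (ler_norm_increment x0x _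
    (fun t _ => is_derive_expR_lin (c / m) m x0 t) _) _.
  - by move=> t ?; apply: fdf; lra.
  - move=> t tx; rewrite mulrA divfK//; apply: le_trans (dfle _ _) _; first lra.
    by rewrite ger0_norm//; lra.
  - by rewrite subrr mulr0 expR0 mulr1 ger0_norm ?subr_ge0// gerBl.
rewrite distrC.
apply: le_trans (ler_norm_increment xx0 _
  (fun t _ => is_derive_expR_lin (- (c / m)) (- m) x0 t) _) _.
- by move=> t ?; apply: fdf; lra.
- move=> t tx; have -> : - (c / m) * (- m * expR (- m * (t - x0))) = c * expR (- m * (t - x0)).
    by rewrite mulrA mulrNN divfK.
  apply: le_trans (dfle _ _) _; first lra.
  by rewrite ler0_norm ?subr_le0 ?mulrN ?mulNr//; lra.
- rewrite subrr mulr0 expR0 mulr1 ler0_norm ?subr_le0// mulNr opprK.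
  by rewrite mulrN -mulNr addrC mulNr gerBl.
Qed.

(** The oriented integral: systems are solved on both sides of [x0]. *)
Definition primitive (R : realType) (x0 : R) (f : R -> R) (x : R) : R :=
  let mu := @lebesgue_measure R in
  if x0 <= x then (\int[mu]_(t in `[x0, x]) f t)%R
  else - (\int[mu]_(t in `[x, x0]) f t)%R.

Lemma continuous_on_seg (R : realType) (I : set R) (f : R -> R) (a b : R) :
  is_interval I -> I a -> I b -> (forall t, I t -> {for t, continuous f}) ->
  {within `[a, b], continuous f}.
Proof.
move=> itvI Ia Ib cf; apply: continuous_in_subspaceT => t.
by rewrite inE/= in_itv/= => tab; apply: cf; exact: (itvI a b).
Qed.

Lemma open_closed_ball (R : realType) (I : set R) x : open I -> I x ->
  exists2 r, 0 < r & forall y, `|x - y| <= r -> I y.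
Proof.
move=> oI Ix; have /nbhs_ballP[r/= r0 rI] : nbhs x I by exact: open_nbhs_nbhs.
exists (r / 2); first by rewrite divr_gt0.
by move=> y xy; apply: rI; rewrite /ball/=; lra.
Qed.

Lemma primitive0 (R : realType) (x0 : R) (f : R -> R) : primitive x0 f x0 = 0.
Proof. by rewrite /primitive lexx set_itv1 Rintegral_set1. Qed.

(** The fundamental theorem is applied to [P], the integral from a point [a] of [I] to the left of
    both [x] and [x0]. Near [x] the oriented integral is [P - P x0], whichever side of [x0] it lies
    on. *)
Lemma is_derive_primitive (R : realType) (I : set R) (x0 : R) (f : R -> R) :
  open I -> is_interval I -> I x0 -> (forall t, I t -> {for t, continuous f}) ->
  forall x, I x -> is_derive x 1 (primitive x0 f) (f x).
Proof.
move=> oI itvI Ix0 cf x Ix.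
pose mu := @lebesgue_measure R.
have intf a b : I a -> I b -> mu.-integrable `[a, b] (EFin \o f).
  move=> Ia Ib; apply: continuous_compact_integrable; first exact: segment_compact.
  exact: (continuous_on_seg itvI).
have [a Ia ax] : exists2 a, I a & a < Order.min x x0.
  have [r r0 rI] := open_closed_ball oI Ix; have [r' r'0 r'I] := open_closed_ball oI Ix0.
  have [xx0|x0x] := leP x x0.
    by exists (x - r); [apply: rI; rewrite subKr gtr0_norm|lra].
  by exists (x0 - r'); [apply: r'I; rewrite subKr gtr0_norm|lra].
move: ax; rewrite lt_min => /andP[ax ax0].
have [b Ib xb] : exists2 b, I b & x < b.
  have [r r0 rI] := open_closed_ball oI Ix.
  by exists (x + r); [apply: rI; rewrite opprD addNKr normrN gtr0_norm|lra].
pose P y := (\int[mu]_(t in `[a, y]) f t)%R.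
have [dP P'] : derivable P x 1 /\ P^`() x = f x.
  by apply: continuous_FTC1_closed (xb) _ ax (cf _ Ix); exact: intf.
have addP y z : I z -> a <= y -> y <= z -> P z - P y = (\int[mu]_(t in `[y, z]) f t)%R.
  move=> Iz ay yz.
  have Iy : I y by apply: (itvI a z) => //; rewrite ay.
  rewrite /P Rintegral_itvB ?bnd_simp//; last exact: intf.
  rewrite Rintegral_itv_obnd_cbnd//.
  by apply: integrableS (intf _ _ Iy Iz) => //; exact: subset_itv_oc_cc.
apply: (@near_eq_is_derive _ _ _ (P - cst (P x0))).
  have [r r0 rI] := open_closed_ball oI Ix.
  have : \forall y \near x, `|x - y| <= r by apply/nbhs_ballP; exists r => //= y /ltW.
  have : \forall y \near x, a < y by exact: lt_nbhsr.
  apply: filterS2 => y ay /rI Iy; rewrite /primitive -/mu.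
  case: leP => x0y; first by rewrite -addP // ltW.
  by rewrite -addP ?opprB// ltW.
rewrite -[f x]subr0; apply: is_deriveB.
by rewrite -P' derive1E; exact: DeriveDef.
Qed.

(** With [h k = 2 * D / 2 ^+ k], the tail of the geometric series, [u - h] increases and [u + h]
    decreases. Monotone convergence gives the limit, and the two sequences bracket it, which is the
    error bound. *)
Lemma geometric_increments_cvg (R : realType) (u : R ^nat) (D : R) :
  (forall k, `|u k.+1 - u k| <= D / 2 ^+ k) ->
  cvgn u /\ forall k, `|limn u - u k| <= 2 * D / 2 ^+ k.
Proof.
move=> uD; pose h k : R := 2 * D / 2 ^+ k.
have hS k : h k = D / 2 ^+ k + h k.+1.
  by rewrite /h exprS; field; rewrite expf_neq0.
have h0 : h k @[k --> \oo] --> (0 : R).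
  have -> : h = geometric (2 * D) (2^-1) by apply/funext => k; rewrite /h /= exprVn.
  by apply: cvg_geometric; rewrite gtr0_norm ?invf_lt1 ?invr_gt0 ?ltr1n ?ltr0n.
have v_nd : nondecreasing_seq (fun k => u k - h k).
  by apply/nondecreasing_seqP => k; have := uD k; have := hS k; rewrite ler_norml; lra.
have w_ni : nonincreasing_seq (fun k => u k + h k).
  by apply/nonincreasing_seqP => k; have := uD k; have := hS k; rewrite ler_norml; lra.
have D0 : 0 <= D by have := uD 0%N; rewrite expr0 divr1; exact: le_trans.
have hge0 k : 0 <= h k by rewrite /h divr_ge0 ?mulr_ge0 ?exprn_ge0.
have v_cvg : cvgn (fun k => u k - h k).
  apply: nondecreasing_is_cvgn => //; exists (u 0%N + h 0%N) => _ [k _ <-].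
  by have := w_ni 0%N k (leq0n k); have := hge0 k; lra.
have u_cvg : cvgn u.
  have -> : u = (fun k => u k - h k) + h by apply/funext => k; rewrite fctE subrK.
  by apply: is_cvgD => //; apply/cvg_ex; exists 0.
have v_lim : (fun k => u k - h k) @ \oo --> limn u.
  by rewrite -[limn u]subr0; exact: cvgB.
have w_lim : (fun k => u k + h k) @ \oo --> limn u.
  by rewrite -[limn u]addr0; exact: cvgD.
split=> // k; rewrite ler_distl; apply/andP; split.
  have := nondecreasing_cvgn_le v_nd v_cvg k.
  by rewrite (cvg_lim _ v_lim).
have := nonincreasing_cvgn_ge w_ni (cvgP _ w_lim) k.
by rewrite (cvg_lim _ w_lim).
Qed.

(** * Picard iteration for linear systems on an open interval *)

Fixpoint picard (R : realType) (N : nat) (x0 : R) (A : 'I_N -> 'I_N -> R -> R)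
    (y0 : 'I_N -> R) (k : nat) (i : 'I_N) (t : R) : R :=
  if k is k'.+1 then
    y0 i + primitive x0 (fun u => \sum_j A i j u * picard x0 A y0 k' j u) t
  else y0 i.

Section Picard.
Context (R : realType) (I : set R) (N : nat) (x0 : R).
Context (A : 'I_N -> 'I_N -> R -> R) (y0 : 'I_N -> R).
Context (oI : open I) (itvI : is_interval I) (Ix0 : I x0).
Context (cA : forall i j x, I x -> {for x, continuous (A i j)}).

Let Y := picard x0 A y0.

Lemma continuous_lincomb (y : 'I_N -> R -> R) i x : I x ->
  (forall j, {for x, continuous (y j)}) ->
  {for x, continuous (fun u => \sum_j A i j u * y j u)}.
Proof.
move=> Ix cy.
have -> : (fun u => \sum_j A i j u * y j u) = \sum_j (A i j \* y j).
  by apply/funext => u; rewrite fct_sumE.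
elim/big_ind : _ => [|f g|j _]; [exact: cvg_cst|exact: continuousD|].
by apply: continuousM; [exact: cA|exact: cy].
Qed.

Lemma picard_continuous k i x : I x -> {for x, continuous (Y k i)}.
Proof.
elim: k i x => [|k IH] i x Ix; first exact: cvg_cst.
apply: continuousD; first exact: cvg_cst.
apply: (@is_derive_continuous _ _ _ (\sum_j A i j x * Y k j x)).
apply: (is_derive_primitive oI itvI Ix0) => // t It.
by apply: continuous_lincomb => // j; exact: IH.
Qed.

Lemma is_derive_picard k i x : I x ->
  is_derive x 1 (Y k.+1 i) (\sum_j A i j x * Y k j x).
Proof.
move=> Ix; rewrite -[\sum_j _]add0r.
apply: is_deriveD.
apply: (is_derive_primitive oI itvI Ix0) => // t It.
by apply: continuous_lincomb => // j; exact: picard_continuous.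
Qed.

Lemma picard_x0 k i : Y k i x0 = y0 i.
Proof. by case: k => [|k] //; rewrite /Y /= primitive0 addr0. Qed.

Lemma finite_bound (J : finType) (f : J -> R -> R) (a b : R) : I a -> I b ->
  (forall j x, I x -> {for x, continuous (f j)}) ->
  exists2 M, 0 < M & forall j t, a <= t <= b -> `|f j t| <= M.
Proof.
move=> Ia Ib cf.
have [ab|ba] := leP a b; last first.
  by exists 1 => // j t; lra.
have /choice[M MP] : forall j, exists M : R, forall t, a <= t <= b -> `|f j t| <= M.
  move=> j; have cn : {within `[a, b], continuous (fun t => `|f j t|)}.
    apply: (continuous_on_seg itvI Ia Ib) => t It.
    by apply: continuous_comp; [exact: cf|exact: norm_continuous].
  have [c _ cP] := EVT_max ab cn.
  by exists `|f j c| => t tab; apply: cP; rewrite in_itv.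
(* The sum dominates each maximum; the 1 keeps the bound positive. *)
exists (1 + \sum_j `|M j|); first by rewrite ltr_pwDl// sumr_ge0.
move=> j t /MP /le_trans; apply; rewrite (bigD1 j)//=.
apply: le_trans (ler_norm _) _; rewrite addrCA lerDl addr_ge0// sumr_ge0//.
Qed.

Lemma lincomb_bound (a b : R) : I a -> I b ->
  exists2 L, 0 < L & forall i t (y : 'I_N -> R) M, a <= t <= b ->
    (forall j, `|y j| <= M) -> `|\sum_j A i j t * y j| <= L * M.
Proof.
move=> Ia Ib.
have [L0 L00 L0P] := @finite_bound ('I_N * 'I_N)%type (fun p => A p.1 p.2) a b Ia Ib
  (fun p => @cA p.1 p.2).
(* [N.+1] rather than [N], so that the constant is positive even for [N = 0]. *)
exists (L0 *+ N.+1) => [|i t y M tab yM]; first by rewrite pmulrn_lgt0.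
have M0 : 0 <= M by apply: le_trans (yM i).
apply: le_trans (ler_norm_sum _ _ _) _.
apply: le_trans (_ : \sum_(j < N) L0 * M <= _).
  by apply: ler_sum => j _; rewrite normrM ler_pM// (L0P (i, j)).
by rewrite sumr_const card_ord -mulrnAl mulrSr mulrDl lerDl mulr_ge0// ltW.
Qed.

(* On [a, b] the integral operator contracts by 1/2 for the sup norm weighted by
   exp(- 2 L |t - x0|), so no factorial estimates are needed. *)
Lemma picard_increment (a b : R) : I a -> I b -> a <= x0 <= b ->
  exists D, forall k i t, a <= t <= b -> `|Y k.+1 i t - Y k i t| <= D / 2 ^+ k.
Proof.
move=> Ia Ib x0ab.
have [L L0 LP] := lincomb_bound Ia Ib.
have [C C0 CP] := @finite_bound 'I_N (fun i => Y 1 i - Y 0 i) a b Ia Ib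
  (fun i x Ix => continuousB (@picard_continuous 1 i x Ix) (@picard_continuous 0 i x Ix)).
have Iab t : a <= t <= b -> I t by exact: itvI.
have bnd k : forall i t, a <= t <= b ->
    `|Y k.+1 i t - Y k i t| <= C / 2 ^+ k * expR (2 * L * `|t - x0|).
  elim: k => [|k IH] i t tab.
    rewrite expr0 divr1; apply: le_trans (CP _ _ tab) _.
    by rewrite ler_peMr ?(ltW C0)// -expR0 ler_expR mulr_ge0// ltW// mulr_gt0.
  pose df u := \sum_j A i j u * (Y k.+1 j u - Y k j u).
  have D u : a <= u <= b -> is_derive u 1 (Y k.+2 i - Y k.+1 i) (df u).
    move=> /Iab Iu; rewrite /df.
    under eq_bigr do rewrite mulrBr; rewrite sumrB.
    by apply: is_deriveB; exact: is_derive_picard.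
  have := @ler_norm_increment_expR R _ df (L * (C / 2 ^+ k)) (2 * L) a b x0 t _ x0ab tab D.
  rewrite -[(_ - _) t]/(Y k.+2 i t - Y k.+1 i t) -[(_ - _) x0]/(Y k.+2 i x0 - Y k.+1 i x0).
  rewrite !picard_x0 subrr subr0.
  have -> : L * (C / 2 ^+ k) / (2 * L) = C / 2 ^+ k.+1.
    by rewrite exprS; field; rewrite expf_neq0// gt_eqF.
  apply; first by rewrite mulr_gt0.
  by move=> u uab; rewrite -mulrA; apply: LP => // j; exact: IH.
(* On [[a, b]] the weight is at most [expR (2 * L * (b - a))], which turns the weighted bound into a
   uniform one. *)
exists (C * expR (2 * L * (b - a))) => k i t tab.
apply: le_trans (bnd _ _ _ tab) _; rewrite [leRHS]mulrAC.
rewrite ler_wpM2l// ?divr_ge0 ?exprn_ge0 ?(ltW C0)//.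
rewrite ler_expR ler_pM2l ?mulr_gt0// ler_norml; lra.
Qed.

Let Z i t := limn (fun k => Y k i t).

Lemma picard_lim (a b : R) : I a -> I b -> a <= x0 <= b ->
  exists2 D, 0 <= D & forall k i t, a <= t <= b -> `|Z i t - Y k i t| <= D / 2 ^+ k.
Proof.
move=> Ia Ib x0ab; have [D DP] := picard_increment Ia Ib x0ab.
exists `|2 * D| => // k i t tab.
have [_ /(_ k)] := @geometric_increments_cvg R (fun k => Y k i t) D
  (fun k => DP k i t tab).
by move=> /le_trans; apply; rewrite ler_pM2r ?invr_gt0 ?exprn_gt0// ler_norm.
Qed.

(** Convergence is uniform only on compact segments containing [x0]; continuity and the fixed-point
    equation at [x] are local, so one such segment that is a neighbourhood of [x] suffices. *)
Lemma seg_nbhs x : I x -> exists a b,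
  [/\ I a, I b, a <= x0 <= b & \forall t \near x, a <= t <= b].
Proof.
move=> Ix; have [r r0 rI] := open_closed_ball oI Ix.
have near_r : \forall t \near x, `|x - t| <= r.
  by apply/nbhs_ballP; exists r => //= y /ltW.
have Im : I (x - r) by apply: rI; rewrite subKr gtr0_norm.
have Ip : I (x + r) by apply: rI; rewrite opprD addNKr normrN gtr0_norm.
have [xx0|x0x] := leP x x0.
  have [x0r|rx0] := leP x0 (x + r).
    exists (x - r), (x + r); split=> //; first by lra.
    by apply: filterS near_r => t; rewrite ler_norml; lra.
  exists (x - r), x0; split=> //; first by lra.
  by apply: filterS near_r => t; rewrite ler_norml; lra.
have [x0r|rx0] := leP (x - r) x0.
  exists (x - r), (x + r); split=> //; first by lra.
  by apply: filterS near_r => t; rewrite ler_norml; lra.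
exists x0, (x + r); split=> //; first by lra.
by apply: filterS near_r => t; rewrite ler_norml; lra.
Qed.

Lemma geometric_small (D e : R) : 0 < e -> exists k, D / 2 ^+ k < e.
Proof.
move=> e0.
have h0 : D / 2 ^+ k @[k --> \oo] --> (0 : R).
  have -> : (fun k => D / 2 ^+ k) = geometric D (2^-1 : R).
    by apply/funext => k; rewrite /= exprVn.
  by apply: cvg_geometric; rewrite gtr0_norm ?invf_lt1 ?invr_gt0 ?ltr1n ?ltr0n.
have [k _ kP] := cvgr_lt _ h0 _ e0.
by exists k; exact: kP (leqnn k).
Qed.

(** A locally uniform limit of continuous functions, by the usual argument with [e / 3]. *)
Lemma picard_lim_continuous i x : I x -> {for x, continuous (Z i)}.
Proof.
move=> Ix; have [a [b [Ia Ib x0ab nab]]] := seg_nbhs Ix.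
have [D D0 DP] := picard_lim Ia Ib x0ab.
apply/cvgrPdist_le => e e0.
have [k ke] : exists k, D / 2 ^+ k < e / 3 by apply: geometric_small; lra.
have cY : \forall t \near x, `|Y k i x - Y k i t| <= e / 3.
  by have /cvgrPdist_le := @picard_continuous k i x Ix; apply; lra.
have xab := nbhs_singleton nab.
apply: filterS2 nab cY => t tab Yt.
have := DP k i t tab; have := DP k i x xab.
move: Yt; rewrite !ler_norml; lra.
Qed.

(** Passing to the limit in the recursion: [F - Y k.+1 i] has derivative
    [\sum_j A i j * (Z j - Y k j)], which is at most [L * (D / 2 ^+ k)] on the segment and hence
    tends to 0 uniformly. *)
Lemma picard_lim_fixpoint i x : I x ->
  Z i x = y0 i + primitive x0 (fun u => \sum_j A i j u * Z j u) x.
Proof.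
move=> Ix; have [a [b [Ia Ib x0ab nab]]] := seg_nbhs Ix.
have xab : a <= x <= b by exact: nbhs_singleton nab.
have [D D0 DP] := picard_lim Ia Ib x0ab.
have [L L0 LP] := lincomb_bound Ia Ib.
set F := primitive x0 _.
have dF t : I t -> is_derive t 1 F (\sum_j A i j t * Z j t).
  apply: (is_derive_primitive oI itvI Ix0) => u Iu.
  by apply: continuous_lincomb => // j; exact: picard_lim_continuous.
pose E := L * expR (1 * `|x - x0|).
have bnd k : `|F x - (Y k.+1 i x - y0 i)| <= (E * D) / 2 ^+ k.
  pose df u := \sum_j A i j u * (Z j u - Y k j u).
  have dFY u : a <= u <= b -> is_derive u 1 (F - Y k.+1 i) (df u).
    move=> uab; have Iu : I u by exact: (itvI Ia Ib).
    rewrite /df; under eq_bigr do rewrite mulrBr; rewrite sumrB.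
    by have ? := dF _ Iu; have ? := is_derive_picard k i Iu; exact: is_deriveB.
  (* The rate 1 is arbitrary here: the weight is at least 1, and the lemma serves only to treat both
     sides of [x0] at once. *)
  have := @ler_norm_increment_expR R _ df (L * (D / 2 ^+ k)) 1 a b x0 x ltr01 x0ab xab dFY.
  rewrite -[(_ - _) x]/(F x - Y k.+1 i x) -[(_ - _) x0]/(F x0 - Y k.+1 i x0).
  rewrite /F primitive0 picard_x0 sub0r opprK -/F opprB addrA addrAC.
  have -> : L * (D / 2 ^+ k) / 1 * expR (1 * `|x - x0|) = E * D / 2 ^+ k.
    by rewrite /E divr1; ring.
  apply=> u uab.
  apply: (@le_trans _ _ (L * (D / 2 ^+ k))); first by apply: LP => // j; exact: DP.
  by rewrite ler_peMr -?expR0 ?ler_expR ?mulr_ge0 ?divr_ge0 ?exprn_ge0 ?(ltW L0).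
apply/eqP; rewrite -subr_eq0 -normr_le0; apply/ler_addgt0Pr => e e0; rewrite add0r.
(* [E * D] accounts for the distance from [F] to the iterate, the extra [D] for the distance from
   the iterate to its limit. *)
have [k ke] := geometric_small (E * D + D) e0.
have := DP k.+1 i x xab; have := bnd k.
have : D / 2 ^+ k.+1 <= D / 2 ^+ k.
  by rewrite ler_wpM2l// exprS invfM ler_piMl ?invr_ge0 ?exprn_ge0// invf_le1 ?ler1n.
move: ke; rewrite mulrDl !ler_norml; lra.
Qed.

Lemma linear_ode : exists y : 'I_N -> R -> R, (forall i, y i x0 = y0 i) /\
  forall i x, I x -> is_derive x 1 (y i) (\sum_j A i j x * y j x).
Proof.
(* The right-hand side of the fixed-point equation is taken rather than [Z], since its derivative is
   immediate; the two agree on [I]. *)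
exists (fun i t => y0 i + primitive x0 (fun u => \sum_j A i j u * Z j u) t).
split=> [i|i x Ix]; first by rewrite primitive0 addr0.
under eq_bigr do rewrite -picard_lim_fixpoint//.
rewrite -[\sum_j _]add0r; apply: is_deriveD.
apply: (is_derive_primitive oI itvI Ix0) => // u Iu.
by apply: continuous_lincomb => // j; exact: picard_lim_continuous.
Qed.

End Picard.

(** * Matrix-valued and smooth functions *)

Lemma is_derive_near_on (R : realType) (V : normedModType R) (I : set R)
    (f g : R -> V) (df : V) (x : R) : open I -> I x -> (forall t, I t -> f t = g t) ->
  is_derive x 1 f df -> is_derive x 1 g df.
Proof.
move=> oI Ix fg; apply: near_eq_is_derive.
by apply: filterS (open_nbhs_nbhs (conj oI Ix)) => t /fg.
Qed.

Lemma derive1_on (R : realType) (V : normedModType R) (I : set R) (f g : R -> V) (x : R) :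
  open I -> I x -> (forall t, I t -> f t = g t) -> derive1 f x = derive1 g x.
Proof.
move=> oI Ix fg; rewrite !derive1E; apply: near_eq_derive.
by apply: filterS (open_nbhs_nbhs (conj oI Ix)) => t /fg.
Qed.

Lemma is_derive_derive1 (R : realType) (V : normedModType R) (f : R -> V) (x : R) :
  derivable f x 1 -> is_derive x 1 f (derive1 f x).
Proof. by move=> df; rewrite derive1E; exact: DeriveDef. Qed.

Lemma derive1_val (R : realType) (V : normedModType R) (f : R -> V) (x : R) (df : V) :
  is_derive x 1 f df -> derive1 f x = df.
Proof. by move=> fdf; rewrite derive1E derive_val. Qed.

Lemma is_derive_mxP (R : realType) (m n : nat) (F : R -> 'M[R]_(m, n))
    (x : R) (dF : 'M[R]_(m, n)) :
  is_derive x 1 F dF <-> forall i j, is_derive x 1 (fun t => F t i j) (dF i j).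
Proof.
split=> [[dv <-] i j|H].
  rewrite derive_mx// mxE; apply: DeriveDef => //.
  by move/derivable_mxP : dv.
have dv : derivable F x 1 by apply/derivable_mxP => i j; exact: ex_derive.
apply: DeriveDef => //; rewrite derive_mx//.
by apply/matrixP => i j; rewrite mxE derive_val.
Qed.

Lemma is_derive_mulmx (R : realType) (m n p : nat) (F : R -> 'M[R]_(m, n))
    (G : R -> 'M[R]_(n, p)) (x : R) (dF : 'M[R]_(m, n)) (dG : 'M[R]_(n, p)) :
  is_derive x 1 F dF -> is_derive x 1 G dG ->
  is_derive x 1 (fun t => F t *m G t) (dF *m G x + F x *m dG).
Proof.
move=> /is_derive_mxP dFx /is_derive_mxP dGx; apply/is_derive_mxP => i j.
have -> : (fun t => (F t *m G t) i j) =
    \sum_k ((fun t => F t i k) * (fun t => G t k j)).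
  by apply/funext => t; rewrite mxE fct_sumE.
apply: is_derive_eq (is_derive_sum (fun k => is_deriveM (dFx i k) (dGx k j))) _.
rewrite !mxE -big_split; apply: eq_bigr => k _.
by rewrite /= addrC -![_ *: _]/(_ * _) [dF i k * _]mulrC.
Qed.

Lemma is_derive_trmx (R : realType) (m n : nat) (F : R -> 'M[R]_(m, n))
    (x : R) (dF : 'M[R]_(m, n)) :
  is_derive x 1 F dF -> is_derive x 1 (fun t => (F t)^T) (dF^T).
Proof.
move=> /is_derive_mxP dFx; apply/is_derive_mxP => i j; rewrite mxE.
by have -> : (fun t => (F t)^T i j) = (fun t => F t j i) by apply/funext => t; rewrite mxE.
Qed.

Lemma is_derive_0_cst_mx (R : realType) (m n : nat) (I : set R)
    (F : R -> 'M[R]_(m, n)) : is_interval I ->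
  (forall t, I t -> is_derive t 1 F 0) -> forall x y, I x -> I y -> F x = F y.
Proof.
move=> itvI F0 x y Ix Iy; apply/matrixP => i j.
apply: (is_derive_0_cst_on (f := fun t => F t i j) itvI) => // t /F0.
by move=> /is_derive_mxP/(_ i j); rewrite mxE.
Qed.

(** Leibniz's expansion is a sum of products of entries. No formula for the derivative is required:
    it will vanish because the square of the determinant is constant. *)
Lemma derivable_det (R : realType) (n : nat) (F : R -> 'M[R]_n) (x : R) :
  derivable F x 1 -> derivable (fun t => \det (F t)) x 1.
Proof.
move=> /derivable_mxP dF; rewrite /determinant.
have -> : (fun t => \sum_(s : {perm 'I_n}) (-1) ^+ s * \prod_i F t i (s i)) =
  \sum_(s : {perm 'I_n}) (cst ((-1) ^+ s) * \prod_i (fun t => F t i (s i))).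
  by apply/funext => t; rewrite fct_sumE; apply: eq_bigr => s _; rewrite /= fct_prodE.
elim/big_ind : _ => [|f g|s _]; [exact: derivable_cst|exact: derivableD|].
apply: derivableM; first exact: derivable_cst.
by elim/big_ind : _ => [|f g|i _]; [exact: derivable_cst|exact: derivableM|].
Qed.

(** The recursion passes to the first derivative, so that sums, products and differential equations
    can be treated by induction on the order. *)
Fixpoint derivable_upto (R : realType) (V : normedModType R) (I : set R) (k : nat)
    (f : R -> V) : Prop :=
  if k is k'.+1 then
    (forall x, I x -> derivable f x 1) /\ derivable_upto I k' (derive1 f)
  else True.

Lemma smooth_onP (R : realType) (V : normedModType R) (I : set R) (f : R -> V) :
  smooth_on I f <-> forall k, derivable_upto I k f.
Proof.
split=> [+ k|].
  elim: k f => [//|k IH] f sf; split; first exact: (sf 0%N).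
  by apply: IH => j x /(sf j.+1); rewrite /derive1n iterSr.
move=> H k; elim: k f H => [|k IH] f H; first exact: (H 1%N).1.
by move=> x Ix; rewrite /derive1n iterSr; apply: IH => // j; exact: (H j.+1).2.
Qed.

Section DerivableUpto.
Context (R : realType) (I : set R) (oI : open I).

Lemma eq_derivable_upto (V : normedModType R) k (f g : R -> V) :
  (forall x, I x -> f x = g x) -> derivable_upto I k f -> derivable_upto I k g.
Proof.
elim: k f g => [//|k IH] f g fg [df Df]; split=> [x Ix|].
  have ? := df _ Ix.
  by have [] := is_derive_near_on oI Ix fg (is_derive_derive1 (df _ Ix)).
by apply: IH Df => x Ix; exact: derive1_on fg.
Qed.

Lemma derivable_uptoS (V : normedModType R) k (f df : R -> V) :
  (forall x, I x -> is_derive x 1 f (df x)) -> derivable_upto I k df ->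
  derivable_upto I k.+1 f.
Proof.
move=> fdf Df; split=> [x /fdf[]//|].
by apply: eq_derivable_upto Df => x /fdf /derive1_val.
Qed.

Lemma derivable_uptoW (V : normedModType R) k (f : R -> V) :
  derivable_upto I k.+1 f -> derivable_upto I k f.
Proof. by elim: k f => [//|k IH] f [df Df]; split=> //; exact: IH. Qed.

Lemma derivable_upto_cst (V : normedModType R) k (v : V) :
  derivable_upto I k (cst v).
Proof.
elim: k v => [//|k IH] v; by apply: derivable_uptoS (IH 0).
Qed.

Lemma derivable_uptoD k (f g : R -> R) :
  derivable_upto I k f -> derivable_upto I k g -> derivable_upto I k (f + g).
Proof.
elim: k f g => [//|k IH] f g [df Df] [dg Dg].
apply: derivable_uptoS (IH _ _ Df Dg) => x Ix.
apply: is_deriveD.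
  exact: is_derive_derive1 (df _ Ix).
exact: is_derive_derive1 (dg _ Ix).
Qed.

Lemma derivable_uptoM k (f g : R -> R) :
  derivable_upto I k f -> derivable_upto I k g -> derivable_upto I k (f * g).
Proof.
elim: k f g => [//|k IH] f g df dg.
(* The product rule involves [f] and [g] themselves next to their derivatives, so both are also
   taken at order [k]. *)
have := derivable_uptoW df; have := derivable_uptoW dg.
move: df dg => [df Df] [dg Dg] Wg Wf.
apply: derivable_uptoS (derivable_uptoD (IH _ _ Wf Dg) (IH _ _ Wg Df)) => x Ix.
apply: is_deriveM.
  exact: is_derive_derive1 (df _ Ix).
exact: is_derive_derive1 (dg _ Ix).
Qed.

Lemma derivable_upto_sum k (J : finType) (f : J -> R -> R) :
  (forall j, derivable_upto I k (f j)) -> derivable_upto I k (\sum_j f j).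
Proof.
move=> fk; elim/big_ind : _ => // [|g h]; last exact: derivable_uptoD.
exact: derivable_upto_cst.
Qed.

Lemma derivable_upto_mx k (m n : nat) (F : R -> 'M[R]_(m, n)) :
  (forall i j, derivable_upto I k (fun x => F x i j)) -> derivable_upto I k F.
Proof.
elim: k F => [//|k IH] F Fk.
have dF x : I x -> derivable F x 1.
  by move=> Ix; apply/derivable_mxP => i j; exact: (Fk i j).1.
split=> //; apply: IH => i j; apply: eq_derivable_upto (Fk i j).2 => x Ix.
apply: derive1_val; move: i j; apply/is_derive_mxP.
exact: is_derive_derive1 (dF _ Ix).
Qed.

(** Bootstrapping: if all components have [k] derivatives, so have the right-hand sides, hence the
    components have [k.+1]. *)
Lemma linear_ode_smooth (N : nat) (A : 'I_N -> 'I_N -> R -> R) (y : 'I_N -> R -> R) :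
  (forall i j, smooth_on I (A i j)) ->
  (forall i x, I x -> is_derive x 1 (y i) (\sum_j A i j x * y j x)) ->
  forall i, smooth_on I (y i).
Proof.
move=> sA dy i; apply/smooth_onP => k; elim: k i => [//|k IH] i.
apply: (derivable_uptoS (dy i)).
have -> : (fun x => \sum_j A i j x * y j x) = \sum_j (A i j * y j).
  by apply/funext => x; rewrite fct_sumE.
by apply: derivable_upto_sum => j; apply: derivable_uptoM => //; have /smooth_onP := sA i j.
Qed.

End DerivableUpto.

(** * Pseudo-orthonormal frames *)

Definition char_mx (R : realType) (n : nat) (eps : nat -> R) : 'M[R]_n :=
  diag_mx (\row_(i < n) eps i.+1).

(* Skew-symmetric; the Frenet equations in sigma read M' = M *m (E *m S) for the
   frame matrix M, with E = char_mx n eps and S = shape_mx n c. *)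
Definition shape_mx (R : realType) (n : nat) (c : nat -> R -> R) (x : R) : 'M[R]_n :=
  \matrix_(k < n, j < n)
    ((if k == j.+1 :> nat then c k x else 0) - (if j == k.+1 :> nat then c j x else 0)).

Lemma diag_mx_sqr1 (R : realType) (n : nat) (v : 'rV[R]_n) :
  (forall i, v 0 i * v 0 i = 1) -> diag_mx v *m diag_mx v = 1%:M.
Proof.
move=> v1; apply/matrixP => i j; rewrite mul_mx_diag !mxE.
by have [<-|] := eqVneq i j; rewrite ?mulr1n ?v1 ?mulr0n ?mul0r.
Qed.

Lemma lmetric_sqr (R : realType) (n : nat) : lmetric R n *m lmetric R n = 1%:M.
Proof. by apply: diag_mx_sqr1 => i; rewrite mxE; case: ifP; rewrite ?mulrNN mulr1. Qed.

Lemma lmetric_tr (R : realType) (n : nat) : (lmetric R n)^T = lmetric R n.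
Proof. exact: tr_diag_mx. Qed.

Lemma det_neq0_sqr1 (R : realType) (n : nat) (A : 'M[R]_n) :
  A *m A = 1%:M -> \det A != 0.
Proof.
move=> /(congr1 determinant); rewrite det_mulmx det1 => /eqP.
by apply: contraL => /eqP ->; rewrite mul0r eq_sym oner_eq0.
Qed.

Section Signs.
Context (R : realType) (n : nat) (eps : nat -> R).
Context (heps : causal_characters n eps).

Lemma eps_sqr i : (1 <= i <= n)%N -> eps i * eps i = 1.
Proof. by have [t [_ H]] := heps => /H ->; case: ifP; rewrite ?mulrNN mulr1. Qed.

Lemma char_mx_sqr : char_mx n eps *m char_mx n eps = 1%:M.
Proof. by apply: diag_mx_sqr1 => i; rewrite mxE eps_sqr/=. Qed.

Lemma char_mx_tr : (char_mx n eps)^T = char_mx n eps.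
Proof. exact: tr_diag_mx. Qed.

(* The right-hand form is the one that is conserved by M' = M E S without solving
   an equation for it: its derivative is M (E S E + E (E S)^T) M^T = 0. *)
Lemma frame_dualP (M : 'M[R]_n) :
  M^T *m lmetric R n *m M = char_mx n eps <->
  M *m char_mx n eps *m M^T = lmetric R n.
Proof.
split=> H.
  have : (char_mx n eps *m M^T *m lmetric R n) *m M = 1%:M.
    by rewrite -char_mx_sqr -{3}H !mulmxA.
  move/mulmx1C; rewrite !mulmxA => /(congr1 (fun A => A *m lmetric R n)) /=.
  by rewrite mul1mx => <-; rewrite -[RHS]mulmxA lmetric_sqr mulmx1.
have : M *m (char_mx n eps *m M^T *m lmetric R n) = 1%:M.
  by rewrite !mulmxA H lmetric_sqr.
move/mulmx1C => /(congr1 (fun A => char_mx n eps *m A)) /=.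
by rewrite mulmx1 !mulmxA char_mx_sqr mul1mx.
Qed.

Lemma shape_mx_skew (c : nat -> R -> R) x : (shape_mx n c x)^T = - shape_mx n c x.
Proof. by apply/matrixP => i j; rewrite !mxE opprB. Qed.

(** [E S] is infinitesimally orthogonal for [E]. This expression is the middle factor in the
    derivative of [N E M^T] for any two solutions [M], [N] of the system. *)
Lemma char_shape_skew (c : nat -> R -> R) x :
  char_mx n eps *m shape_mx n c x *m char_mx n eps +
  char_mx n eps *m (char_mx n eps *m shape_mx n c x)^T = 0.
Proof. by rewrite trmx_mul shape_mx_skew char_mx_tr mulNmx mulmxN mulmxA subrr. Qed.

Lemma frame_det_sqr (M : 'M[R]_n) :
  M^T *m lmetric R n *m M = char_mx n eps ->
  \det (lmetric R n) * \det M ^+ 2 = \det (char_mx n eps).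
Proof.
by move=> /(congr1 determinant); rewrite !det_mulmx det_tr => <-; rewrite expr2; ring.
Qed.

Lemma p_orthogonal_det_sqr (A : 'M[R]_n) :
  A^T *m lmetric R n *m A = lmetric R n -> \det A ^+ 2 = 1.
Proof.
move=> /(congr1 determinant); rewrite !det_mulmx det_tr => H.
apply: (mulIf (det_neq0_sqr1 (lmetric_sqr R n))).
by rewrite mul1r -[RHS]H expr2; ring.
Qed.

(** A permuted standard basis: transposing positions 1 and [t] carries the timelike direction of the
    metric to the timelike vector of the frame. Rescaling one column by [delta], a sign, then
    adjusts the determinant without affecting the Gram matrix. *)
Lemma exists_frame (d : R) : d = 1 \/ d = -1 -> exists M : 'M[R]_n,
  M *m char_mx n eps *m M^T = lmetric R n /\ \det M = d.
Proof.
move=> d1; have dd : d * d = 1 by case: d1 => ->; rewrite ?mulrNN mulr1.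
have [t [/andP[t0 tn] epst]] := heps.
have n0 : (0 < n)%N by exact: leq_trans tn.
have t1n : (t.-1 < n)%N by rewrite prednK.
pose p := tperm (Ordinal n0) (Ordinal t1n).
pose delta := d * (-1) ^+ p : R.
have dd1 : delta * delta = 1.
  by rewrite /delta mulrACA dd mul1r -expr2 sqrr_sign.
pose v := \row_(i < n) (if i == 0%N :> nat then delta else 1) : 'rV[R]_n.
have vv : diag_mx v *m diag_mx v = 1%:M.
  by apply: diag_mx_sqr1 => i; rewrite mxE; case: ifP; rewrite ?mulr1.
exists (perm_mx p *m diag_mx v); split.
  rewrite trmx_mul tr_diag_mx tr_perm_mx !mulmxA.
  rewrite -(mulmxA _ (diag_mx v) (char_mx n eps)) [diag_mx v *m _]diag_mxC.
  rewrite -!mulmxA (mulmxA (diag_mx v)) vv mul1mx.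
  rewrite mulmxA -row_permE -col_permE; apply/matrixP => i j.
  rewrite !mxE (inj_eq perm_inj).
  have [_|//] := eqVneq i j; rewrite !mulr1n epst/=; last exact: ltn_ord.
  congr (if _ then _ else _).
  rewrite -(prednK t0) eqSS -[RHS]/(i == Ordinal n0).
  by rewrite -[LHS]/(p i == Ordinal t1n) -(tpermL (Ordinal n0) (Ordinal t1n)) -/p (inj_eq perm_inj).
rewrite det_mulmx det_perm det_diag.
rewrite (bigD1 (Ordinal n0))//= mxE/= big1 ?mulr1; last first.
  by move=> i i0; rewrite mxE ifF//; apply: contra_neqF i0 => /eqP i0; exact: val_inj.
by rewrite /delta mulrCA -expr2 sqrr_sign mulr1.
Qed.

End Signs.

Section Frames.
Context (R : realType) (n : nat).

Lemma lprodZl a (u v : 'cV[R]_n) : lprod (a *: u) v = a * lprod u v.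
Proof. by rewrite /lprod linearZ/= -!scalemxAl mxE. Qed.

Lemma lprodZr a (u v : 'cV[R]_n) : lprod u (a *: v) = a * lprod u v.
Proof. by rewrite /lprod -scalemxAr mxE. Qed.

Lemma lprodDl (u u' v : 'cV[R]_n) : lprod (u + u') v = lprod u v + lprod u' v.
Proof. by rewrite /lprod linearD/= !mulmxDl mxE. Qed.

Lemma lprodNl (u v : 'cV[R]_n) : lprod (- u) v = - lprod u v.
Proof. by rewrite -scaleN1r lprodZl mulN1r. Qed.

Lemma lprod0l (v : 'cV[R]_n) : lprod 0 v = 0.
Proof. by rewrite -(scale0r 0) lprodZl mul0r. Qed.

Lemma frame_gram (e : nat -> R -> 'cV[R]_n) x (i j : 'I_n) :
  ((frame_mx e x)^T *m lmetric R n *m frame_mx e x) i j = lprod (e i.+1 x) (e j.+1 x).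
Proof.
have colE (k : 'I_n) : col k (frame_mx e x) = e k.+1 x.
  by apply/colP => l; rewrite !mxE.
rewrite /lprod -!colE tr_col -row_mul.
by rewrite [LHS]mxE [RHS]mxE; apply: eq_bigr => k _; rewrite [row _ _ _ _]mxE [col _ _ _ _]mxE.
Qed.

(** Column [j] holds [e j.+1]. The two conditions cut off the neighbours beyond either end of the
    frame. *)
Lemma frame_mul_shape (eps : nat -> R) (c : nat -> R -> R)
    (e : nat -> R -> 'cV[R]_n) x (i j : 'I_n) :
  (frame_mx e x *m (char_mx n eps *m shape_mx n c x)) i j =
  (if (j.+1 < n)%N then eps j.+2 * c j.+1 x * e j.+2 x i 0 else 0) -
  (if (0 < j)%N then eps j * c j x * e j x i 0 else 0).
Proof.
rewrite mulmxA mxE.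
(* The two off-diagonals of the shape matrix are summed separately; each meets column [j] in at most
   one row. *)
have -> : \sum_k (frame_mx e x *m char_mx n eps) i k * shape_mx n c x k j =
    \sum_(k < n | k == j.+1 :> nat) (eps k.+1 * c k x * e k.+1 x i 0) -
    \sum_(k < n | k.+1 == j :> nat) (eps k.+1 * c k.+1 x * e k.+1 x i 0).
  rewrite [X in X - _]big_mkcond [X in _ - X]big_mkcond -sumrB.
  apply: eq_bigr => k _; rewrite /char_mx mul_mx_diag !mxE [j == _ :> nat]eq_sym.
  case: eqP => [k1|_]; case: eqP => [k2|_]; rewrite ?subr0 ?sub0r ?mulr0 ?mulrN//.
  - by rewrite k1 in k2; lia.
  - by ring.
  - by rewrite k2; congr (- _); ring.
congr (_ - _).
  by rewrite (big_ord1_eq _ (fun k => eps k.+1 * c k x * e k.+1 x i 0)).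
case: j => -[|j] /= jn; first by rewrite big_pred0.
under eq_bigl do rewrite eqSS.
by rewrite (big_ord1_eq _ (fun k => eps k.+1 * c k.+1 x * e k.+1 x i 0)) ltnW.
Qed.

End Frames.

(** * The Frenet system in the spherical parameter *)

(* kappa_i / kappa_1, hence 1 at i = 1; the value 1 outside 1 <= i <= n - 1 is
   never read by shape_mx. *)
Definition shape_coef (R : realType) (n : nat) (z : nat -> R -> R) (i : nat) : R -> R :=
  if (2 <= i <= n.-1)%N then z i else cst 1.

(* Everything expressed in the spherical parameter sigma, with q = ds/dsigma =
   1 / kappa_1. *)
Record frenet_system (R : realType) (n : nat) (I : set R) (eps : nat -> R) (d : R)
    (z : nat -> R -> R) (alpha : R -> 'cV[R]_n) (q : R -> R)
    (e : nat -> R -> 'cV[R]_n) : Prop := {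
  system_neq0 : forall x, I x -> q x != 0 ;
  system_scale : forall x, I x -> is_derive x 1 q (z 1%N x * q x) ;
  system_curve : forall x, I x -> is_derive x 1 alpha (q x *: e 1%N x) ;
  system_frame : forall x, I x -> is_derive x 1 (frame_mx e)
    (frame_mx e x *m (char_mx n eps *m shape_mx n (shape_coef n z) x)) ;
  system_gram : forall x, I x ->
    (frame_mx e x)^T *m lmetric R n *m frame_mx e x = char_mx n eps ;
  system_det : forall x, I x -> \det (frame_mx e x) = d
}.

(** The bridge between the matrix equation and the Frenet equations: the conditionals merge the
    first, middle and last equations into one. *)
Lemma is_derive_frame (R : realType) (n : nat) (eps : nat -> R) (c : nat -> R -> R)
    (e : nat -> R -> 'cV[R]_n) (x : R) :
  is_derive x 1 (frame_mx e) (frame_mx e x *m (char_mx n eps *m shape_mx n c x)) <->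
  forall l, (1 <= l <= n)%N -> is_derive x 1 (e l)
    ((if (l < n)%N then (eps l.+1 * c l x) *: e l.+1 x else 0) -
     (if (1 < l)%N then (eps l.-1 * c l.-1 x) *: e l.-1 x else 0)).
Proof.
have colE (j : 'I_n) i : (fun t => frame_mx e t i j) = (fun t => e j.+1 t i 0).
  by apply/funext => t; rewrite mxE.
split=> [/is_derive_mxP H l /andP[l0 ln]|H]; apply/is_derive_mxP => i j.
  have l1n : (l.-1 < n)%N by rewrite prednK.
  have := H i (Ordinal l1n); rewrite frame_mul_shape colE/= (prednK l0) ord1.
  rewrite mxE.
  have -> : (0 < l.-1)%N = (1 < l)%N by lia.
  by case: ifP => _; case: ifP => _; rewrite !mxE.
rewrite frame_mul_shape colE; have := H j.+1; rewrite ltn_ord => /(_ isT)/is_derive_mxP/(_ i 0).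
by rewrite mxE/= ltnS; case: ifP => _; case: ifP => _; rewrite !mxE.
Qed.

(** * From curves to the linear system, and uniqueness *)

Section System.
Context (R : realType) (n : nat) (I : set R) (oI : open I) (itvI : is_interval I).
Context (eps : nat -> R) (heps : causal_characters n eps) (hn : (2 <= n)%N).
Context (z : nat -> R -> R).

(** As [dds s] is [q^-1] times the derivative in sigma, the spherical normalization says that the
    first curvature is [q^-1], and the i-th one is then [q^-1 * shape_coef n z i]. Multiplying the
    Frenet equations by [q] cancels this factor, and the condition on [z 1] becomes [q' = z_1 q]. *)
Lemma has_p_shape_curvatures_system d (alpha : R -> 'cV[R]_n) :
  has_p_shape_curvatures I eps d z alpha ->
  exists q e, frenet_system I eps d z alpha q e.
Proof.
move=> [salpha [_ [s [e [als ff det [_ kq] psc]]]]].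
pose q : R -> R := derive1 s.
have q0 x : I x -> q x != 0 by move=> Ix; case: als => _ /(_ _ Ix) [].
have k1 x : I x -> curvature s e 1 x = (q x)^-1.
  move=> Ix; rewrite -kq// /dds (derive1_val (is_derive_id _ _)) -/(q x).
  exact: mulr1.
have dq x : I x -> is_derive x 1 q (derive1 q x).
  by move=> Ix; apply: is_derive_derive1; exact: (als.1 1%N).
have kc i x : (1 <= i <= n.-1)%N -> I x ->
    curvature s e i x = (q x)^-1 * shape_coef n z i x.
  move=> /andP[i1 i2] Ix; rewrite /shape_coef i2 andbT.
  have [i1'|i1'] := ltnP 1 i; last first.
    have -> : i = 1%N by lia.
    by rewrite k1 //= mulr1.
  have := psc i x; rewrite i1 i2 => /(_ isT Ix); rewrite /p_shape_curvature gtn_eqF// k1//.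
  by move=> <-; rewrite invrK mulrC mulfK// q0.
have scale x F : I x -> derive1 F x = q x *: dds s F x :> 'cV[R]_n.
  by move=> Ix; rewrite /dds scalerA mulfV ?scale1r// q0.
exists q, e; split=> //.
- move=> x Ix; apply: is_derive_eq (dq _ Ix) _.
  have := psc 1%N x; rewrite /p_shape_curvature/= => <- //; last by lia.
  have -> : derive1 (curvature s e 1) x = - (q x) ^- 2 *: derive1 q x.
    rewrite (derive1_on oI Ix k1); apply: derive1_val.
    by apply: is_deriveV; [exact: q0|exact: dq].
  rewrite k1// invrK -[_ *: _]/(_ * _); field; exact: q0.
- move=> x Ix; rewrite (frenet_tangent ff)// -scale//.
  by apply: is_derive_derive1; exact: (salpha 0%N).
- move=> x Ix; apply/is_derive_frame => l ln.
  apply: is_derive_eq (is_derive_derive1 (frenet_smooth ff ln (k := 0%N) Ix)) _.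
  rewrite scale//.
  have [l1|l1] := leqP l 1.
    have -> : l = 1%N by lia.
    rewrite (frenet_first ff Ix) hn subr0 scalerA; congr (_ *: _).
    rewrite kc//; last by lia.
    by rewrite mulrCA mulVKf// q0.
  have [ln'|ln'] := leqP n l.
    have ln1 : l = n by lia.
    rewrite ln1 sub0r (frenet_last ff Ix) scaleNr scalerN scalerA; congr (- (_ *: _)).
    rewrite kc//; last by lia.
    by rewrite mulrCA mulVKf// q0.
  rewrite (frenet_mid ff)//; last by lia.
  rewrite kc//; last by lia.
  rewrite kc//; last by lia.
  rewrite addrC scalerDr scaleNr scalerN !scalerA.
  by congr (_ *: _ - _ *: _); rewrite mulrCA mulVKf// q0.
- move=> x Ix; apply/matrixP => i j; rewrite frame_gram.
  rewrite (frenet_orthonormal ff)//; try exact: ltn_ord.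
  by rewrite !mxE eqSS -[(i == j :> nat)]/(i == j); case: eqP => [->|].
Qed.

Lemma system_unique d d' (alpha beta : R -> 'cV[R]_n) q q' e e' : (~~ odd n -> d = d') ->
  frenet_system I eps d z alpha q e -> frenet_system I eps d' z beta q' e' ->
  exists f, p_similarity f /\ forall sigma, I sigma -> beta sigma = f (alpha sigma).
Proof.
move=> dd Sa Sb.
(* On an empty interval the identity will do. *)
have [[x0 Ix0]|nI] := pselect (exists x, I x); last first.
  exists id; split; last by move=> x Ix; case: nI; exists x.
  exists 1, 1%:M, 0; split; rewrite ?oner_eq0 ?det1 ?trmx1 ?mul1mx ?mulmx1//.
  by move=> x; rewrite mul1mx scale1r addr0.
pose E := char_mx n eps; pose G := lmetric R n.
pose M := frame_mx e; pose N := frame_mx e'; pose S := shape_mx n (shape_coef n z).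
have EE : E *m E = 1%:M by exact: char_mx_sqr.
have GG : G *m G = 1%:M by exact: lmetric_sqr.
have Ginv (P : 'M[R]_n) : P *m G *m G = P by rewrite -mulmxA GG mulmx1.
have Einv (P : 'M[R]_n) : P *m E *m E = P by rewrite -mulmxA EE mulmx1.
pose A x := N x *m E *m (M x)^T *m G.
have dA x : I x -> is_derive x 1 A 0.
  move=> Ix.
  have dN := is_derive_mulmx (system_frame Sb Ix) (is_derive_cst E x 1).
  have dM := is_derive_trmx (system_frame Sa Ix).
  apply: is_derive_eq (is_derive_mulmx (is_derive_mulmx dN dM) (is_derive_cst G x 1)) _.
  rewrite !mulmx0 !addr0.
  rewrite trmx_mul -/M -/N -/E -/S.
  (* Both frames obey the same system, so the derivative factors through the expression that
     vanishes by [char_shape_skew]. *)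
  have -> : N x *m (E *m S x) *m E *m (M x)^T + N x *m E *m ((E *m S x)^T *m (M x)^T) =
     N x *m (E *m S x *m E + E *m (E *m S x)^T) *m (M x)^T.
    by rewrite mulmxDr mulmxDl !mulmxA.
  by rewrite char_shape_skew mulmx0 mul0mx mul0mx.
have cA x : I x -> A x = A x0 by move=> Ix; exact: is_derive_0_cst_mx itvI dA _ _ Ix Ix0.
have NA x : I x -> N x = A x0 *m M x.
  move=> Ix; rewrite -(cA x Ix) /A -!mulmxA [(M x)^T *m _]mulmxA (system_gram Sa Ix).
  by rewrite -/E EE mulmx1.
have e1A x : I x -> e' 1%N x = A x0 *m e 1%N x.
  move=> Ix; have n0 : (0 < n)%N by exact: ltnW.
  have colE (h : nat -> R -> 'cV[R]_n) : h 1%N x = col (Ordinal n0) (frame_mx h x).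
    by apply/colP => i; rewrite !mxE.
  by rewrite !colE -/N NA// !matrix.colE mulmxA.
have MEM : M x0 *m E *m (M x0)^T = G by apply/(frame_dualP heps); exact: system_gram Sa _ Ix0.
have AG : (A x0)^T *m G *m A x0 = G.
  have -> : (A x0)^T *m G *m A x0 =
      G *m (M x0 *m E *m ((N x0)^T *m G *m N x0) *m E *m (M x0)^T) *m G.
    by rewrite /A !trmx_mul trmxK lmetric_tr char_mx_tr !mulmxA.
  by rewrite (system_gram Sb Ix0) -/E Einv MEM GG mul1mx.
have detA : \det (A x0) * d = d'.
  by rewrite -(system_det Sb Ix0) -(system_det Sa Ix0) -/N -/M NA// [RHS]det_mulmx.
(* The Gram matrix [E] is invertible, hence so is the frame matrix. *)
have d0 : d != 0.
  have := frame_det_sqr (system_gram Sa Ix0); rewrite (system_det Sa Ix0) => Ed.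
  have := det_neq0_sqr1 EE; rewrite -Ed; apply: contra_neq => ->.
  by rewrite expr0n mulr0.
have q0 x : I x -> q x != 0 by exact: system_neq0 Sa _.
pose mu := q' x0 / q x0.
have mu0 : mu != 0 by rewrite mulf_neq0 ?invr_eq0 ?(system_neq0 Sb) ?(system_neq0 Sa).
have qmu x : I x -> q' x = mu * q x.
  (* Two solutions of [y' = z_1 y] have a constant ratio. *)
  move=> Ix; have dr t : I t -> is_derive t 1 (q' * (fun y => (q y)^-1)) 0.
    move=> It; have dV := is_deriveV (q0 t It) (system_scale Sa It).
    apply: is_derive_eq (is_deriveM (system_scale Sb It) dV) _.
    rewrite -![_ *: _]/(_ * _); field; exact: q0.
  have := is_derive_0_cst_on itvI dr Ix Ix0; rewrite !mulrfctE -/mu => <-.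
  by rewrite divfK// q0.
pose b := beta x0 - mu *: (A x0 *m alpha x0).
have betaE x : I x -> beta x = mu *: (A x0 *m alpha x) + b.
  move=> Ix; pose F t := beta t - mu *: (A x0 *m alpha t).
  have dF t : I t -> is_derive t 1 F 0.
    move=> It.
    have dl := is_derive_mulmx (is_derive_cst (A x0) t 1) (system_curve Sa It).
    have := is_deriveB (system_curve Sb It) (is_deriveZ mu dl).
    rewrite mul0mx add0r qmu// e1A// -scalemxAr scalerA subrr.
    by [].
  have := is_derive_0_cst_mx itvI dF Ix Ix0; rewrite /b -/(F x0) => <-.
  by rewrite /F addrC subrK.
have detA2 := p_orthogonal_det_sqr AG.
have [detA1|detA1] := eqVneq (\det (A x0)) 1.
  exists (fun y => mu *: (A x0 *m y) + b); split=> //.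
  by exists mu, (A x0), b; split.
have detAN : \det (A x0) = -1.
  by move/eqP: detA2; rewrite sqrf_eq1 (negPf detA1) => /eqP.
(* In even dimension [d = d'], and [detA] would force [\det (A x0) = 1]. *)
have oddn : odd n.
  apply: contra_neqT detA1 => /dd ddE; apply: (mulIf d0).
  by rewrite detA mul1r.
exists (fun y => mu *: (A x0 *m y) + b); split=> //.
(* In odd dimension negation changes the sign of the determinant, while the product of [mu] and [A]
   stays the same. *)
exists (- mu), (- A x0), b; split.
- by rewrite oppr_eq0.
- by rewrite [(- A x0)^T]raddfN mulNmx mulmxN mulNmx opprK.
- by rewrite -scaleN1r detZ detAN -signr_odd oddn expr1 mulrNN mulr1.
- by move=> y; rewrite mulNmx scaleNr scalerN opprK.
Qed.

End System.

(** * Existence and smoothness of solutions *)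

Section Existence.
Context (R : realType) (n : nat) (I : set R) (oI : open I) (itvI : is_interval I).
Context (eps : nat -> R) (heps : causal_characters n eps) (hn : (2 <= n)%N).
Context (z : nat -> R -> R).
Context (hz : forall i, (1 <= i <= n.-1)%N -> smooth_on I (z i)).

(** The indices are swapped because the matrix acts on the right: each row of the frame matrix
    solves the same scalar system. *)
Let A (j k : 'I_n) (x : R) := (char_mx n eps *m shape_mx n (shape_coef n z) x) k j.

Lemma shape_coef_smooth i : smooth_on I (shape_coef n z i).
Proof.
rewrite /shape_coef; case: ifP => [/andP[i2 i1]|_]; first by apply: hz; rewrite i1 ltnW.
by apply/smooth_onP => k; exact: derivable_upto_cst.
Qed.

Lemma ode_coef_smooth j k : smooth_on I (A j k).
Proof.
apply/smooth_onP => m.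
(* The index tests do not depend on the parameter; [b] moves them outside the functions, so that
   closure under sums and products applies. *)
pose b (p : bool) i := if p then shape_coef n z i else cst 0.
have sb p i : derivable_upto I m (b p i).
  rewrite /b; case: p; last exact: derivable_upto_cst.
  by have /smooth_onP := @shape_coef_smooth i.
have -> : A j k = cst (eps k.+1) * (b (k == j.+1 :> nat) k + cst (-1) * b (j == k.+1 :> nat) j).
  apply/funext => x; rewrite /A /char_mx mul_diag_mx !mxE /b.
  rewrite -[RHS]/(eps k.+1 * (_ x + (-1) * _ x)) mulN1r.
  by case: ifP => _; case: ifP.
apply: derivable_uptoM => //; first exact: derivable_upto_cst.
apply: derivable_uptoD => //; apply: derivable_uptoM => //.
exact: derivable_upto_cst.
Qed.

Lemma smooth_on_continuous (f : R -> R) x : smooth_on I f -> I x -> {for x, continuous f}.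
Proof.
by move=> sf Ix; apply: is_derive_continuous (is_derive_derive1 (sf 0%N x Ix)).
Qed.

Lemma system_exists (d x0 : R) : I x0 -> d = 1 \/ d = -1 ->
  exists alpha q (e : nat -> R -> 'cV[R]_n),
    frenet_system I eps d z alpha q e /\ forall x, I x -> 0 < q x.
Proof.
move=> Ix0 d1.
have sz1 : smooth_on I (z 1%N) by apply: hz; lia.
have n0 : (0 < n)%N by exact: ltnW.
(* The explicit solution of [q' = z_1 q] with value 1 at [x0]; as an exponential it is positive,
   which the signs of the curvatures require. *)
pose q (x : R) : R := expR (primitive x0 (z 1%N) x).
have dq x : I x -> is_derive x 1 q (z 1%N x * q x).
  move=> Ix; have dp := is_derive_primitive oI itvI Ix0 (fun t => smooth_on_continuous sz1) Ix.
  by apply: is_derive_eq (is_derive1_comp (is_derive_expR _) dp) _; rewrite mulrC.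
have [M0 [M0E M0d]] := exists_frame heps d1.
have /choice[Y YP] : forall i, exists y : 'I_n -> R -> R, (forall j, y j x0 = M0 i j) /\
    forall j x, I x -> is_derive x 1 (y j) (\sum_k A j k x * y k x).
  move=> i; apply: linear_ode => // j k x.
  by apply: smooth_on_continuous; exact: ode_coef_smooth.
(* Frame vectors count from 1 and columns from 0; beyond [n] the vector is 0. *)
pose e l x : 'cV[R]_n := \col_i (if insub l.-1 is Some j then Y i j x else 0).
have eE (j : 'I_n) x i : e j.+1 x i 0 = Y i j x by rewrite mxE/= valK.
have ME x : frame_mx e x = \matrix_(i, j) Y i j x.
  by apply/matrixP => i j; rewrite [RHS]mxE -eE [LHS]mxE.
have dM x : I x -> is_derive x 1 (frame_mx e)
    (frame_mx e x *m (char_mx n eps *m shape_mx n (shape_coef n z) x)).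
  move=> Ix; apply/is_derive_mxP => i j.
  have -> : (fun t => frame_mx e t i j) = Y i j by apply/funext => t; rewrite ME mxE.
  apply: is_derive_eq ((YP i).2 j x Ix) _; rewrite ME [RHS]mxE.
  by apply: eq_bigr => k _; rewrite mulrC [in RHS]mxE.
have Mx0 : frame_mx e x0 = M0 by rewrite ME; apply/matrixP => i j; rewrite mxE (YP i).1.
have gram x : I x -> (frame_mx e x)^T *m lmetric R n *m frame_mx e x = char_mx n eps.
  (* The dual form [M E M^T] has zero derivative and equals the metric at [x0] by the choice of
     [M0]. *)
  move=> Ix; apply/(frame_dualP heps); rewrite -[RHS]M0E -Mx0.
  apply: (is_derive_0_cst_mx
    (F := fun t => frame_mx e t *m char_mx n eps *m (frame_mx e t)^T) itvI) Ix Ix0 => t It.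
  have dME := is_derive_mulmx (dM _ It) (is_derive_cst (char_mx n eps) t 1).
  apply: is_derive_eq (is_derive_mulmx dME (is_derive_trmx (dM _ It))) _.
  rewrite mulmx0 addr0 trmx_mul -[cst _ t]/(char_mx n eps).
  have -> (M : 'M[R]_n) (K E : 'M[R]_n) : M *m K *m E *m M^T + M *m E *m (K^T *m M^T) =
      M *m (K *m E + E *m K^T) *m M^T.
    by rewrite mulmxDr mulmxDl !mulmxA.
  by rewrite char_shape_skew// mulmx0 mul0mx.
have det x : I x -> \det (frame_mx e x) = d.
  have dd : d ^+ 2 = 1 by case: d1 => ->; rewrite ?sqrrN expr1n.
  have det2 t : I t -> \det (frame_mx e t) * \det (frame_mx e t) = 1.
    move=> It; rewrite -expr2 -dd -M0d -Mx0.
    apply: (mulfI (det_neq0_sqr1 (lmetric_sqr R n))).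
    by rewrite (frame_det_sqr (gram _ It)) (frame_det_sqr (gram _ Ix0)).
  move=> Ix; rewrite -M0d -Mx0.
  apply: (is_derive_0_cst_on (f := fun t => \det (frame_mx e t)) itvI) Ix Ix0 => t It.
  have dt := is_derive_derive1 (derivable_det (@ex_derive _ _ _ _ _ _ _ (dM _ It))).
  apply: (is_derive_eq dt).
  (* Differentiating [det ^+ 2 = 1] gives [2 * det * det' = 0], and [det] is nonzero. *)
  have d11 := is_derive_near_on oI It (fun u Iu => esym (det2 u Iu)) (is_derive_cst (1 : R) t 1).
  have := is_deriveM dt dt.
  move=> /derive1_val; rewrite (derive1_val d11) => /esym/eqP.
  rewrite -![_ *: _]/(_ * _) -mulr2n mulrn_eq0/= mulf_eq0 => /orP[|/eqP//].
  by move=> /eqP dt0; have := det2 t It; rewrite dt0 mul0r => /esym/eqP; rewrite oner_eq0.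
pose alpha x : 'cV[R]_n := \col_i primitive x0 (fun t => q t * e 1%N t i 0) x.
exists alpha, q, e; split; last by move=> x _; exact: expR_gt0.
split=> //.
- by move=> x _; rewrite gt_eqF ?expR_gt0.
- move=> x Ix; apply/is_derive_mxP => i j; rewrite ord1 mxE.
  have -> : (fun t => alpha t i 0) = primitive x0 (fun t => q t * e 1%N t i 0).
    by apply/funext => t; rewrite mxE.
  apply: (is_derive_primitive oI itvI Ix0) Ix => t It.
  apply: continuousM; first exact: is_derive_continuous (dq _ It).
  have -> : (fun t => e 1%N t i 0) = Y i (Ordinal n0).
    by apply/funext => u; rewrite -eE.
  exact: is_derive_continuous ((YP i).2 _ _ It).
Qed.

Section SystemCurve.
Context (d : R) (alpha : R -> 'cV[R]_n) (q : R -> R) (e : nat -> R -> 'cV[R]_n).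
Context (Sa : frenet_system I eps d z alpha q e).

(** The equation for [q] is a linear system of size 1, so bootstrapping applies. *)
Lemma system_scale_smooth : smooth_on I q.
Proof.
have sz1 : smooth_on I (z 1%N) by apply: hz; lia.
apply: (@linear_ode_smooth R I oI 1 (fun _ _ => z 1%N) (fun=> q)) ord0 => // i x Ix.
by rewrite big_ord1; exact: system_scale Sa _ Ix.
Qed.

Lemma system_frame_smooth_entry i (j : 'I_n) : smooth_on I (fun t => e j.+1 t i 0).
Proof.
have -> : (fun t => e j.+1 t i 0) = (fun t => frame_mx e t i j).
  by apply/funext => t; rewrite mxE.
apply: (linear_ode_smooth oI ode_coef_smooth (y := fun j t => frame_mx e t i j)) => {}j x Ix.
have /is_derive_mxP/(_ i j) dij := system_frame Sa Ix.
apply: (is_derive_eq dij); rewrite [LHS]mxE.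
by apply: eq_bigr => m _; rewrite mulrC.
Qed.

Lemma system_frame_smooth l : (1 <= l <= n)%N -> smooth_on I (e l).
Proof.
move=> /andP[l0 ln]; have l1n : (l.-1 < n)%N by rewrite prednK.
apply/smooth_onP => k; apply: derivable_upto_mx => // i j; rewrite ord1.
have /smooth_onP/(_ k) := @system_frame_smooth_entry i (Ordinal l1n).
by rewrite /= prednK.
Qed.

Lemma system_curve_smooth : smooth_on I alpha.
Proof.
apply/smooth_onP => k; apply: derivable_upto_mx => // i j; rewrite ord1.
have D x : I x -> is_derive x 1 (fun t => alpha t i 0) ((q * (fun t => e 1%N t i 0)) x).
  move=> Ix; have /is_derive_mxP/(_ i 0) := system_curve Sa Ix.
  by rewrite mxE.
apply: derivable_uptoW; apply: derivable_uptoS D _ => //.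
apply: derivable_uptoM => //; first by have /smooth_onP := system_scale_smooth.
by have /smooth_onP := @system_frame_smooth_entry i (Ordinal (ltnW hn)).
Qed.
End SystemCurve.
End Existence.

(** The way back from the system to the curve: the arc length [s] is a primitive of [q], and
    orthonormality reads the curvatures off the derivatives of the frame. *)
Lemma system_has_p_shape_curvatures (R : realType) (n : nat) (I : set R)
    (eps : nat -> R) (z : nat -> R -> R) (d x0 : R) (alpha : R -> 'cV[R]_n) (q : R -> R)
    (e : nat -> R -> 'cV[R]_n) :
  open I -> is_interval I -> causal_characters n eps -> (2 <= n)%N ->
  (forall i, (1 <= i <= n.-1)%N -> smooth_on I (z i)) ->
  (forall i x, (2 <= i <= n - 2)%N -> I x -> 0 < z i x) ->
  (forall x, (3 <= n)%N -> I x -> z n.-1 x != 0) ->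
  I x0 -> frenet_system I eps d z alpha q e -> (forall x, I x -> 0 < q x) ->
  has_p_shape_curvatures I eps d z alpha.
Proof.
move=> oI itvI heps hn hz hz_pos hz_neq0 Ix0 Sa q_gt0.
have sq : smooth_on I q by exact: system_scale_smooth Sa.
have se l : (1 <= l <= n)%N -> smooth_on I (e l) by exact: system_frame_smooth Sa _.
have q0 x : I x -> q x != 0 by move=> /q_gt0; rewrite lt0r => /andP[].
have dalpha x : I x -> derive1 alpha x = q x *: e 1%N x.
  by move=> Ix; exact: derive1_val (system_curve Sa Ix).
have orth i j x : (1 <= i <= n)%N -> (1 <= j <= n)%N -> I x ->
    lprod (e i x) (e j x) = if i == j then eps i else 0.
  move=> /andP[i0 i_n] /andP[j0 jn] Ix.
  have i1n : (i.-1 < n)%N by rewrite prednK.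
  have j1n : (j.-1 < n)%N by rewrite prednK.
  have := frame_gram e x (Ordinal i1n) (Ordinal j1n).
  rewrite (system_gram Sa Ix) /= !prednK// => <-; rewrite !mxE/= prednK//.
  have -> : (Ordinal i1n == Ordinal j1n) = (i == j).
    by apply/eqP/eqP => [[ij]|ij]; [lia|apply: val_inj; rewrite /= ij].
  by case: eqP.
have eps2 i : (1 <= i <= n)%N -> eps i * eps i = 1 by exact: eps_sqr.
have norm_eps i : (1 <= i <= n)%N -> Num.sqrt `|eps i| = 1.
  move=> hi; suff -> : `|eps i| = 1 by rewrite sqrtr1.
  by have [t [_ ->//]] := heps; case: ifP; rewrite ?normrN normr1.
pose s := primitive x0 q.
have ds x : I x -> is_derive x 1 s (q x).
  by apply: (is_derive_primitive oI itvI Ix0) => t It; exact: smooth_on_continuous sq It.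
have ds1 x : I x -> derive1 s x = q x by move=> /ds /derive1_val.
have de l x : (1 <= l <= n)%N -> I x -> derive1 (e l) x =
    (if (l < n)%N then (eps l.+1 * shape_coef n z l x) *: e l.+1 x else 0) -
    (if (1 < l)%N then (eps l.-1 * shape_coef n z l.-1 x) *: e l.-1 x else 0).
  move=> ln Ix; apply: derive1_val.
  by have /is_derive_frame := system_frame Sa Ix; apply.
have curvE i x : (1 <= i <= n.-1)%N -> I x ->
    curvature s e i x = (q x)^-1 * shape_coef n z i x.
  (* Pairing with [e i.+1] kills the [e i.-1] term, and the two factors [eps i.+1] multiply to 1. *)
  move=> hi Ix; rewrite /curvature /dds ds1// lprodZl de//; last by lia.
  have -> : (i < n)%N by lia.
  rewrite lprodDl lprodNl lprodZl orth//; try lia.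
  rewrite eqxx mulrAC eps2 ?mul1r; last by lia.
  case: ifP => i1; last by rewrite lprod0l subr0.
  rewrite lprodZl orth//; try lia.
  by rewrite ifF ?mulr0 ?subr0//; apply/eqP; lia.
have curv1 x : I x -> curvature s e 1 x = (q x)^-1.
  by move=> Ix; rewrite curvE; [rewrite /shape_coef/= mulr1|lia|].
have ddse l x : I x -> dds s (e l) x = (q x)^-1 *: derive1 (e l) x.
  by move=> Ix; rewrite /dds ds1.
split; first exact: system_curve_smooth Sa.
split.
  move=> x Ix; rewrite dalpha// lprodZl lprodZr orth//; try lia.
  rewrite eqxx !mulf_neq0 ?q0//; apply/eqP => e0.
  have n1 : (1 <= 1 <= n)%N by lia.
  by have /esym/eqP := eps2 _ n1; rewrite e0 mul0r oner_eq0.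
exists s, e; split.
- split.
    apply/smooth_onP => k; apply: derivable_uptoW; apply: derivable_uptoS ds _ => //.
    by have /smooth_onP := sq.
  move=> x Ix; rewrite ds1//; split; first exact: q0.
  rewrite /lnorm /dds ds1// dalpha// scalerA mulVf ?q0// scale1r orth//; try lia.
  by rewrite eqxx norm_eps//; lia.
- split=> //.
  + by move=> x Ix; rewrite /dds ds1// dalpha// scalerA mulVf ?q0// scale1r.
  + move=> x Ix; rewrite ddse// de//; last by lia.
    rewrite hn/= subr0 scalerA; congr (_ *: _).
    by rewrite curv1// /shape_coef/= mulr1 mulrC.
  + move=> i x hi Ix; rewrite ddse// de//; last by lia.
    have -> : (i < n)%N by lia.
    have -> : (1 < i)%N by lia.
    rewrite !curvE//; try lia.
    rewrite addrC scalerDr scalerN scaleNr !scalerA.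
    by congr (- (_ *: _) + _ *: _); rewrite mulrCA.
  + move=> x Ix; rewrite ddse// de//; last by lia.
    rewrite ltnn hn sub0r scalerN scaleNr scalerA curvE//; last by lia.
    by congr (- (_ *: _)); rewrite mulrCA.
  + move=> j x hj Ix; rewrite curvE//; last by lia.
    rewrite mulr_gt0 ?invr_gt0 ?q_gt0//.
    (* For [j = 1] the coefficient is 1 and positivity comes from [q] alone. *)
    rewrite /shape_coef; case: ifP => j2; last by [].
    by apply: hz_pos => //; lia.
  + move=> x Ix; rewrite curvE//; last by lia.
    (* For [n = 2] the last curvature is the first one, with coefficient 1. *)
    rewrite mulf_neq0 ?invr_eq0 ?q0// /shape_coef leqnn andbT.
    by case: ifP => n3; [apply: hz_neq0 => //; lia|rewrite /= oner_eq0].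
- exact: system_det Sa.
- split; last first.
    by move=> x Ix; rewrite curv1// /dds ds1// (derive1_val (is_derive_id _ _)) -[RHS]mulr1.
  split.
    apply/smooth_onP => k; apply: derivable_uptoW.
    have idd (x : R) : I x -> is_derive x 1 (fun t : R => t) (cst 1 x).
      by move=> _; exact: is_derive_id.
    by apply: derivable_uptoS idd _ => //; exact: derivable_upto_cst.
  move=> x Ix; have d1 : derive1 (fun sigma : R => sigma) x = 1.
    exact: derive1_val (is_derive_id _ _).
  rewrite d1 oner_eq0; split=> //.
  (* The derivative of [e 1] in sigma is [eps 2 *: e 2], a unit vector. *)
  rewrite /lnorm /dds d1 invr1 scale1r de//; last by lia.
  rewrite hn/= subr0 lprodZl lprodZr orth//; try lia.
  rewrite eqxx /shape_coef/= mulr1 eps2 ?mulr1 ?norm_eps//; lia.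
- move=> i x hi Ix; rewrite /p_shape_curvature.
  case: eqP => [->|i1]; last first.
    rewrite curvE// curv1// invrK mulrAC mulVf ?q0// mul1r /shape_coef ifT//.
    by lia.
  rewrite (derive1_on oI Ix curv1) curv1// invrK.
  rewrite (derive1_val (is_deriveV (q0 _ Ix) (system_scale Sa Ix))).
  by rewrite -[_ *: _]/(_ * _); field; exact: q0.
Qed.

Theorem theorem8 (R : realType) (n : nat) (hn : (2 <= n)%N)
    (I : set R) (hI : open_interval I)
    (z : nat -> R -> R)
    (hz : forall i, (1 <= i <= n.-1)%N -> smooth_on I (z i))
    (hz_pos : forall i x, (2 <= i <= n - 2)%N -> I x -> 0 < z i x)
    (hz_neq0 : forall x, (3 <= n)%N -> I x -> z n.-1 x != 0)
    (eps : nat -> R) (heps : causal_characters n eps) :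
  (forall d : R, d = 1 \/ d = -1 ->
     exists alpha : R -> 'cV[R]_n, has_p_shape_curvatures I eps d z alpha) /\
  (forall (d d' : R) (alpha beta : R -> 'cV[R]_n),
     (~~ odd n -> d = d') ->
     has_p_shape_curvatures I eps d z alpha ->
     has_p_shape_curvatures I eps d' z beta ->
     exists f : 'cV[R]_n -> 'cV[R]_n,
       p_similarity f /\ forall sigma, I sigma -> beta sigma = f (alpha sigma)).
Proof.
have [oI itvI] := hI; split=> [d d1|d d' alpha beta dd].
  have [[x0 Ix0]|nI] := pselect (exists x, I x).
    have [alpha [q [e [Sa q_gt0]]]] := system_exists oI itvI heps hn hz Ix0 d1.
    exists alpha.
    exact: (system_has_p_shape_curvatures oI itvI heps hn hz hz_pos hz_neq0 Ix0 Sa).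
  (* On an empty interval every requirement is vacuous and any curve will do. *)
  have I0 x : I x -> False by move=> Ix; apply: nI; exists x.
  exists (fun=> 0); split; [by move=> k x /I0|split; first by move=> x /I0].
  exists id, (fun _ _ => 0); split.
  - by split=> [k x /I0//|x /I0].
  - by split=> [i _ k x /I0//|i j x _ _ /I0//|x /I0//|x /I0//|i x _ /I0//
                |x /I0//|j x _ /I0//|x /I0].
  - by move=> x /I0.
  - by split=> [|x /I0//]; split=> [k x /I0//|x /I0].
  - by move=> i x _ /I0.
move=> /(has_p_shape_curvatures_system oI hn)[q [e Sa]].
move=> /(has_p_shape_curvatures_system oI hn)[q' [e' Sb]].
exact: system_unique dd Sa Sb.
Qed.
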